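(* Let $G=(V,\mathcal D,\mathcal B)$ be an acyclic directed mixed graph, let $b\in V$, and let $c\in C=\operatorname{de}(b)\setminus\{b\}$. Then $\sigma(\mathcal D_{bc})$ is regression identifiable if and only if $b$ is fixable in the induced subgraph $G_{\operatorname{an}(c)}$. In particular, in that case $\sigma(\mathcal D_{bc})=\beta_{bc\cdot S(c)}$ where $S(c)=\operatorname{mb}_{\operatorname{an}(c)}(b)$.
   Context: An acyclic directed mixed graph (ADMG) $G=(V,\mathcal D,\mathcal B)$ has a finite vertex set $V$, a set $\mathcal D$ of directed edges and a set $\mathcal B$ of bidirected edges, with no loops and no directed cycles; a pair of vertices may be joined by both a directed and a bidirected edge. The parameters of the linear structural equation model of $G$ are pairs $(\Lambda,\Omega)$ where $\Lambda=(\lambda_{ij})\in\mathbb R^{V\times V}$ has $\lambda_{ij}=0$ unless $i\to j\in\mathcal D$, and $\Omega=(\omega_{ij})$ is symmetric positive definite with $\omega_{ij}=0$ unless $i=j$ or $i\leftrightarrow j\in\mathcal B$. The covariance matrix is $\Sigma=(\sigma_{ij})=(I-\Lambda)^{-T}\Omega(I-\Lambda)^{-1}$. $\operatorname{pa}(v)$ is the set of parents of $v$; $\operatorname{an}(v)$ and $\operatorname{de}(v)$ are the sets of ancestors and descendants of $v$ (via directed paths), both including $v$. For a set, $\operatorname{pa}(S)=\bigcup_{v\in S}\operatorname{pa}(v)$. $G_W$ is the induced subgraph on $W\subseteq V$. The district $\operatorname{dis}(v)$ is the set of vertices connected to $v$ by a path of bidirected edges (including $v$). The Markov blanket is $\operatorname{mb}(v)=\operatorname{pa}(\operatorname{dis}(v))\cup(\operatorname{dis}(v)\setminus\{v\})$.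 $\operatorname{dis}_S(v)$ and $\operatorname{mb}_S(v)$ denote the district and Markov blanket of $v$ computed in $G_S$. A vertex $v$ is fixable in a graph if $\operatorname{de}(v)\cap\operatorname{dis}(v)=\{v\}$ in that graph. $\mathcal D_{bc}$ is the set of directed paths from $b$ to $c$ in $G$, and $\sigma(\mathcal D_{bc})=\sum_{\tau\in\mathcal D_{bc}}\prod_{x\to y\in\tau}\lambda_{xy}$. $\beta_{vw\cdot S}=\sigma_{vw\cdot S}/\sigma_{vv\cdot S}$, where $\sigma_{vw\cdot S}=\sigma_{vw}-\Sigma_{vS}\Sigma_{SS}^{-1}\Sigma_{Sw}$. The quantity $\sigma(\mathcal D_{bc})$ is regression identifiable if there is a set $S\subseteq V\setminus\{b,c\}$ such that $\sigma(\mathcal D_{bc})=\beta_{bc\cdot S}$ for all parameters $(\Lambda,\Omega)$. *)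

(* Defs.v *)
From HB Require Import structures.
From mathcomp Require Import all_boot all_order all_algebra.
From mathcomp Require Import reals.

Set Implicit Arguments.
Unset Strict Implicit.
Unset Printing Implicit Defensive.

Import Order.TTheory GRing.Theory Num.Theory.
Local Open Scope ring_scope.

(* [cycle dir [:: x]] is [dir x x], so [dir_acyclic] also excludes directed
   loops.  Nothing prevents [dir x y] and [bid x y] from holding together. *)
Record admg (V : finType) := ADMG {
  dir : rel V;
  bid : rel V;
  dir_acyclic : forall s : seq V, cycle dir s -> s = [::];
  bid_irr : irreflexive bid;
  bid_sym : symmetric bid
}.

Definition restr_rel (V : finType) (W : {set V}) (e : rel V) : rel V :=
  fun x y => [&& x \in W, y \in W & e x y].

Lemma restr_acyclic (V : finType) (G : admg V) (W : {set V}) (s : seq V) :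
  cycle (restr_rel W (dir G)) s -> s = [::].
Proof.
move=> h; apply: (dir_acyclic (a := G)).
by apply: sub_cycle h => x y /and3P[].
Qed.

Lemma restr_irr (V : finType) (G : admg V) (W : {set V}) :
  irreflexive (restr_rel W (bid G)).
Proof. by move=> x; rewrite /restr_rel bid_irr !andbF. Qed.

Lemma restr_sym (V : finType) (G : admg V) (W : {set V}) :
  symmetric (restr_rel W (bid G)).
Proof. by move=> x y; rewrite /restr_rel bid_sym andbCA. Qed.

(* The induced subgraph G_W, kept on the ambient vertex type: the vertices
   outside W have no incident edges, so the parents, ancestors, descendants,
   district and Markov blanket of a vertex of W are those it has in G_W. *)
Definition induced (V : finType) (G : admg V) (W : {set V}) : admg V :=
  ADMG (@restr_acyclic V G W) (restr_irr G W) (restr_sym G W).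

Definition pa (V : finType) (G : admg V) (S : {set V}) : {set V} :=
  [set u | [exists v in S, dir G u v]].

(* [connect] is the reflexive transitive closure, so v belongs to each of
   an(v), de(v) and dis(v). *)
Definition an (V : finType) (G : admg V) (v : V) : {set V} :=
  [set u | connect (dir G) u v].

Definition de (V : finType) (G : admg V) (v : V) : {set V} :=
  [set w | connect (dir G) v w].

Definition dis (V : finType) (G : admg V) (v : V) : {set V} :=
  [set w | connect (bid G) v w].

Definition mb (V : finType) (G : admg V) (v : V) : {set V} :=
  pa G (dis G v) :|: (dis G v :\ v).

Definition fixable (V : finType) (G : admg V) (v : V) : Prop :=
  de G v :&: dis G v = [set v].

(* R^(V x V), through the enumeration of V. *)
Notation vmatrix R V := 'M[R]_#|V|.

Definition entry (R : realFieldType) (V : finType) (A : vmatrix R V)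
    (v w : V) : R :=
  A (enum_rank v) (enum_rank w).

Definition posdef (R : realFieldType) (n : nat) (A : 'M[R]_n) : Prop :=
  A^T = A /\ forall x : 'cV[R]_n, x != 0 -> 0 < (x^T *m A *m x) 0 0.

Definition lsem_params (R : realFieldType) (V : finType) (G : admg V)
    (L Om : vmatrix R V) : Prop :=
  [/\ forall i j : V, ~~ dir G i j -> entry L i j = 0,
      posdef Om
    & forall i j : V, i != j -> ~~ bid G i j -> entry Om i j = 0].

Definition covariance (R : realFieldType) (V : finType)
    (L Om : vmatrix R V) : vmatrix R V :=
  (invmx (1%:M - L))^T *m Om *m invmx (1%:M - L).

(* A directed path from b to c is encoded as the list t of its vertices after
   b, so that its edges are the pairs in [zip (b :: t) t].  Its vertices are
   pairwise distinct, hence t has fewer than #|V| elements. *)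
Definition dpath (V : finType) (G : admg V) (b c : V) (t : seq V) : bool :=
  [&& path (dir G) b t, last b t == c & uniq (b :: t)].

Definition path_sum (R : realFieldType) (V : finType) (G : admg V)
    (L : vmatrix R V) (b c : V) : R :=
  \sum_(k < #|V|) \sum_(t : k.-tuple V | dpath G b c t)
    \prod_(e <- zip (b :: t) t) entry L e.1 e.2.

Definition block (R : realFieldType) (V : finType) (A : vmatrix R V)
    (S : {set V}) : 'M[R]_#|S| :=
  \matrix_(i, j) entry A (enum_val i) (enum_val j).

Definition row_block (R : realFieldType) (V : finType) (A : vmatrix R V)
    (v : V) (S : {set V}) : 'rV[R]_#|S| :=
  \row_j entry A v (enum_val j).

Definition col_block (R : realFieldType) (V : finType) (A : vmatrix R V)
    (S : {set V}) (w : V) : 'cV[R]_#|S| :=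
  \col_i entry A (enum_val i) w.

Definition partial_cov (R : realFieldType) (V : finType) (A : vmatrix R V)
    (v w : V) (S : {set V}) : R :=
  entry A v w
  - (row_block A v S *m invmx (block A S) *m col_block A S w) 0 0.

Definition beta (R : realFieldType) (V : finType) (A : vmatrix R V)
    (v w : V) (S : {set V}) : R :=
  partial_cov A v w S / partial_cov A v v S.

Definition regression_identified_by (R : realFieldType) (V : finType)
    (G : admg V) (b c : V) (S : {set V}) : Prop :=
  S \subset [set: V] :\: [set b; c] /\
  forall L Om : vmatrix R V, lsem_params G L Om ->
    path_sum G L b c = beta (covariance L Om) b c S.

Definition regression_identifiable (R : realFieldType) (V : finType)
    (G : admg V) (b c : V) : Prop :=
  exists S : {set V}, regression_identified_by R G b c S.

(* Main.v *)
Require Import Defs.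
From HB Require Import structures.
From mathcomp Require Import all_boot all_order all_algebra.
From mathcomp Require Import reals.

(* Call y a residual of b on S when y_b = 1, y vanishes off S + b and Sigma y
   vanishes on S; then sigma_{bv.S} = (Sigma y)_v for every v.

   If b is fixable in G_an(c), let D be its district there and w the residual
   of b on D - b for Omega.  Since Omega has no entry between D and an(c) - D,
   Omega w vanishes on an(c) - b, so y = (I - Lambda) w is supported on mb(b)
   + b and (Sigma y)_v = sigma(D_bv) (Omega w)_b for v in an(c).  This is 0 on
   mb(b), which contains no descendant of b, and the ratio of the values at c
   and b is sigma(D_bc).

   Conversely let S identify sigma(D_bc).  Suppose S meets a directed path
   from b to c, last at s.  Let b flow along single edges to s and s to c, with
   weights 1, and let Omega = I: then sigma(D_bc) = 1 although s separates b
   from c.  So S contains no vertex of de(b) in an(c).  If some v <> b in de(b)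
   lies in the district of b in G_an(c), let every vertex of an(c) off
   S + {b, c} keep one outgoing edge, towards c.  Each vertex of an(c) then
   flows to a terminal in S + {b, c}, and v flows to c.  A bidirected path from
   b to v thus projects to a path of terminals from b to c, and Omega can be
   chosen so that Sigma couples only consecutive terminals of that path.  No
   directed path from b to c is left, so Sigma y vanishes at c as well, and
   this forces y = 0 along the path, from c back to b, contradicting
   y_b = 1. *)

Set Implicit Arguments.
Unset Strict Implicit.
Unset Printing Implicit Defensive.

Import Order.TTheory GRing.Theory Num.Theory.
Local Open Scope ring_scope.

(** Vectors are functions on [V], which keeps the enumeration of [V] out of the computations. *)
Definition act (R : realFieldType) (V : finType) (A : vmatrix R V)
  (y : V -> R) (v : V) : R := \sum_u entry A v u * y u.

Definition fun_mx (R : realFieldType) (V : finType) (F : V -> V -> R) :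
  vmatrix R V := \matrix_(i, j) F (enum_val i) (enum_val j).

(** With [A] read as a covariance matrix, [y] holds the coefficients of the error left by regressing
    [b] on [S], and [act A y v] is the covariance of that error with [v]. *)
Definition residual (R : realFieldType) (V : finType) (A : vmatrix R V)
    (b : V) (S : {set V}) (y : V -> R) : Prop :=
  [/\ y b = 1, forall u, u \notin b |: S -> y u = 0
    & forall s, s \in S -> act A y s = 0].

(** * Residuals and partial covariances *)

Section Algebra.
Context (R : realFieldType) (V : finType).
Implicit Types (A B L Om : vmatrix R V) (y w : V -> R) (S : {set V}).

Lemma fun_mxE (F : V -> V -> R) u v : entry (fun_mx F) u v = F u v.
Proof. by rewrite /entry mxE !enum_rankK. Qed.

Lemma entry_inj A B : (forall u v, entry A u v = entry B u v) -> A = B.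
Proof.
move=> AB; apply/matrixP=> i j.
by have := AB (enum_val i) (enum_val j); rewrite /entry !enum_valK.
Qed.

Lemma sum_enum_rank (F : 'I_#|V| -> R) : \sum_i F i = \sum_v F (enum_rank v).
Proof. by apply: reindex; apply: onW_bij; apply: enum_rank_bij. Qed.

Lemma entryM A B u v : entry (A *m B) u v = \sum_x entry A u x * entry B x v.
Proof. by rewrite /entry mxE sum_enum_rank. Qed.

Lemma entry_tr A u v : entry A^T u v = entry A v u.
Proof. by rewrite /entry mxE. Qed.

Lemma entry1 u v : entry (1%:M : vmatrix R V) u v = (u == v)%:R.
Proof. by rewrite /entry mxE (inj_eq enum_rank_inj). Qed.

Lemma entryB A B u v : entry (A - B) u v = entry A u v - entry B u v.
Proof. by rewrite /entry !mxE. Qed.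

Lemma act_mul A B y v : act (A *m B) y v = act A (act B y) v.
Proof.
rewrite /act; under eq_bigr do rewrite entryM mulr_suml.
rewrite exchange_big; apply: eq_bigr => x _.
by rewrite mulr_sumr; apply: eq_bigr => u _; rewrite mulrA.
Qed.

Lemma act1 y v : act 1%:M y v = y v.
Proof.
rewrite /act (bigD1 v) //= entry1 eqxx mul1r big1 ?addr0 // => u uv.
by rewrite entry1 eq_sym (negbTE uv) mul0r.
Qed.

Lemma actB A y w v : act A (fun u => y u - w u) v = act A y v - act A w v.
Proof. by rewrite /act -sumrB; apply: eq_bigr => u _; rewrite mulrBr. Qed.

Lemma act_ext A y w v : y =1 w -> act A y v = act A w v.
Proof. by move=> yw; apply: eq_bigr => u _; rewrite yw. Qed.

Lemma act_tr_dot A y w :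
  \sum_u w u * act A y u = \sum_u act A^T w u * y u.
Proof.
under eq_bigr do rewrite mulr_sumr.
rewrite exchange_big; apply: eq_bigr => x _ /=.
by rewrite mulr_suml; apply: eq_bigr => u _; rewrite entry_tr mulrCA mulrA.
Qed.

Lemma quadE A (x : 'cV[R]_#|V|) :
  (x^T *m A *m x) 0 0 =
  \sum_u x (enum_rank u) 0 * act A (fun v => x (enum_rank v) 0) u.
Proof.
rewrite -mulmxA mxE sum_enum_rank; apply: eq_bigr => u _.
by rewrite !mxE sum_enum_rank.
Qed.

Lemma posdefP A :
  posdef A <->
  (forall u v, entry A u v = entry A v u) /\
  (forall y, (exists u, y u != 0) -> 0 < \sum_u y u * act A y u).
Proof.
split=> [[symA posA] | [symA posA]].
  split=> [u v | y [u yu]]; first by rewrite -{1}symA entry_tr.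
  pose x : 'cV[R]_#|V| := \col_i y (enum_val i).
  have xE v : x (enum_rank v) 0 = y v by rewrite mxE enum_rankK.
  have x0 : x != 0.
    by apply: contra_neq yu => x0; rewrite -xE x0 mxE.
  have := posA x x0; rewrite quadE.
  rewrite (eq_bigr (fun u => y u * act A y u)) // => v _.
  by rewrite xE (act_ext _ _ xE).
split; first by apply: entry_inj => u v; rewrite entry_tr.
move=> x x0; rewrite quadE; apply: (posA (fun v => x (enum_rank v) 0)).
by case/cV0Pn: x0 => i xi; exists (enum_val i); rewrite enum_valK.
Qed.

Lemma posdef_unit n (A : 'M[R]_n) : posdef A -> A \in unitmx.
Proof.
case=> _ posA; rewrite unitmxE unitfE; apply/negP=> /det0P[v v0 vA].
have := posA v^T; rewrite trmxK vA mul0mx mxE ltxx trmx_eq0 => /(_ v0).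
by [].
Qed.

(** The inner sum is the extension of [z] by zero outside [S]. *)
Lemma sum_extend S (z : 'cV[R]_#|S|) (F : V -> R) :
  \sum_u F u * (\sum_j (enum_val j == u)%:R * z j 0) =
  \sum_j F (enum_val j) * z j 0.
Proof.
under eq_bigr do rewrite mulr_sumr.
rewrite exchange_big; apply: eq_bigr => j _ /=.
rewrite (bigD1 (enum_val j)) //= eqxx mul1r big1 ?addr0 // => u uj.
by rewrite eq_sym (negbTE uj) mul0r mulr0.
Qed.

Lemma posdef_block A S : posdef A -> posdef (block A S).
Proof.
move=> pA; have [symA posA] := (posdefP A).1 pA.
split; first by apply/matrixP=> i j; rewrite !mxE.
move=> x /cV0Pn[i xi].
pose y u := \sum_j (enum_val j == u)%:R * x j 0.
have yE j : y (enum_val j) = x j 0.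
  rewrite /y (bigD1 j) //= eqxx mul1r big1 ?addr0 // => k kj.
  by rewrite (inj_eq enum_val_inj) (negbTE kj) mul0r.
have := posA y (ex_intro _ (enum_val i) _); rewrite yE => /(_ xi).
rewrite -mulmxA mxE; congr (0 < _).
under eq_bigr do rewrite mulrC.
rewrite sum_extend; apply: eq_bigr => j _; rewrite mulrC !mxE.
congr (_ * _); rewrite /act sum_extend; apply: eq_bigr => k _.
by rewrite !mxE.
Qed.

Lemma residual_exists A b S : posdef A -> b \notin S ->
  exists2 y, residual A b S y & forall v, partial_cov A b v S = act A y v.
Proof.
move=> pA bS; have [symA _] := (posdefP A).1 pA.
have pB := posdef_block S pA; have uB := posdef_unit pB.
(* Minus the regression coefficients of [b] on [S]: the choice that makes [act A y] vanish on
   [S]. *)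
pose z := - (invmx (block A S) *m col_block A S b).
pose y u := (u == b)%:R + \sum_j (enum_val j == u)%:R * z j 0.
have actE v : act A y v = entry A v b + \sum_j entry A v (enum_val j) * z j 0.
  rewrite /act; under eq_bigr do rewrite mulrDr.
  rewrite big_split /= sum_extend (bigD1 b) //= eqxx mulr1.
  by rewrite [X in _ + X + _]big1 ?addr0 // => u /negbTE ->; rewrite mulr0.
exists y.
  split.
  - rewrite /y eqxx big1 ?addr0 // => j _.
    suff /negbTE -> : enum_val j != b by rewrite mul0r.
    by apply: contraNneq bS => <-; apply: enum_valP.
  - move=> u; rewrite !inE negb_or => /andP[/negbTE ub uS].
    rewrite /y ub add0r big1 // => j _.
    suff /negbTE -> : enum_val j != u by rewrite mul0r.
    by apply: contraNneq uS => <-; apply: enum_valP.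
  - move=> s sS; rewrite actE -(enum_rankK_in sS sS).
    set i := enum_rank_in _ _.
    have : (block A S *m z) i 0 = - col_block A S b i 0.
      by rewrite /z mulmxN mulmxA mulmxV // mul1mx mxE.
    rewrite !mxE => zE; apply/eqP; rewrite addr_eq0 -eqr_oppLR -zE.
    by apply/eqP/eq_bigr => j _; rewrite !mxE.
move=> v; rewrite actE /partial_cov symA; congr (_ + _).
have -> : \sum_j entry A v (enum_val j) * z j 0 = (row_block A v S *m z) 0 0.
  by rewrite mxE; apply: eq_bigr => j _; rewrite !mxE.
rewrite /z mulmxN [in RHS]mxE; congr (- _).
have blkT : (block A S)^T = block A S by case: pB.
have rT x : (row_block A x S)^T = col_block A S x.
  by apply/matrixP=> i j; rewrite !mxE.
(* Transposing a 1 x 1 matrix exchanges the roles of [b] and [v]. *)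
have tr00 (M : 'M[R]_1) : M 0 0 = M^T 0 0 by rewrite mxE.
rewrite tr00 !trmx_mul trmx_inv blkT rT -[col_block A S v]rT trmxK.
by [].
Qed.

(** The difference d of two residuals is supported on [S], where A d vanishes, so d^T A d = 0. *)
Lemma residual_unique A b S y w : posdef A ->
  residual A b S y -> residual A b S w -> y =1 w.
Proof.
move=> /posdefP[_ posA] [yb yS yr] [wb wS wr] u.
apply/eqP; rewrite -subr_eq0; apply/negPn/negP=> du.
have := posA (fun u => y u - w u) (ex_intro _ u du).
rewrite big1 ?ltxx // => x _; rewrite actB.
have [->|xb] := eqVneq x b; first by rewrite yb wb subrr mul0r.
have [xS|xS] := boolP (x \in S); first by rewrite yr // wr // subrr mulr0.
by rewrite yS ?wS ?subrr ?mul0r // !inE negb_or xb xS.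
Qed.

Lemma partial_cov_residual A b S y v : posdef A -> b \notin S ->
  residual A b S y -> partial_cov A b v S = act A y v.
Proof.
move=> pA bS ry; have [w rw ->] := residual_exists pA bS.
by apply: act_ext; apply: (residual_unique pA rw ry).
Qed.

(** Only the term at [b] survives in y^T A y: on [S] the vector A y vanishes, and elsewhere [y]
    does. *)
Lemma residual_gt0 A b S y : posdef A -> b \notin S ->
  residual A b S y -> 0 < act A y b.
Proof.
move=> /posdefP[_ posA] bS [yb yS yr].
have := posA y (ex_intro _ b _); rewrite yb oner_eq0 => /(_ isT).
rewrite (bigD1 b) //= yb mul1r big1 ?addr0 // => x xb.
have [xS|xS] := boolP (x \in S); first by rewrite yr // mulr0.
by rewrite yS ?mul0r // !inE negb_or xb xS.
Qed.

(** Clears the denominator, which is the positive conditional variance of [b]. *)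
Lemma beta_residual A b c S y t : posdef A -> b \notin S ->
  residual A b S y -> (beta A b c S = t <-> act A y c = t * act A y b).
Proof.
move=> pA bS ry; rewrite /beta !(partial_cov_residual _ pA bS ry).
have /lt0r_neq0 g0 := residual_gt0 pA bS ry.
by split=> [<-|->]; [rewrite divfK | rewrite mulfK].
Qed.

Lemma act_covariance L Om y v :
  act (covariance L Om) y v =
  \sum_u entry (invmx (1%:M - L)) u v *
    act Om (act (invmx (1%:M - L)) y) u.
Proof.
rewrite /covariance -mulmxA act_mul; apply: eq_bigr => u _.
by rewrite entry_tr act_mul.
Qed.

(** With w = (I - Lambda)^{-1} y the quadratic form becomes w^T Omega w, and w is nonzero when y
    is. *)
Lemma posdef_covariance L Om : 1%:M - L \in unitmx -> posdef Om ->
  posdef (covariance L Om).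
Proof.
move=> uL pO; have [symO posO] := (posdefP Om).1 pO.
apply/posdefP; split.
  move=> u v; rewrite -[in RHS]entry_tr /covariance !trmx_mul trmxK.
  by case: pO => -> _; rewrite mulmxA.
move=> y [u yu]; pose w := act (invmx (1%:M - L)) y.
have -> : \sum_u y u * act (covariance L Om) y u = \sum_u w u * act Om w u.
  rewrite /covariance -mulmxA.
  under eq_bigr do rewrite act_mul.
  rewrite [LHS]act_tr_dot trmxK.
  by apply: eq_bigr => x _; rewrite act_mul.
apply: posO; apply/existsP; apply: contraNT yu => /existsPn w0.
rewrite -[y u]act1 -(mulmxV uL) act_mul; apply/eqP.
by apply: big1 => x _; have /negPn/eqP wx := w0 x; rewrite -/(w x) wx mulr0.
Qed.

End Algebra.

(** * Directed paths *)

Section Graph.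
Context (V : finType) (G : admg V).
Implicit Types (u v x b c : V) (W : {set V}) (e : rel V) (p : seq V).

Lemma dir_no_cycle u v : dir G u v -> connect (dir G) v u -> False.
Proof.
move=> uv /connectP[p vp up].
have /dir_acyclic : cycle (dir G) (v :: p) by rewrite /= rcons_path vp -up.
by [].
Qed.

Lemma dir_neq u v : dir G u v -> u != v.
Proof.
by move=> uv; apply/eqP=> euv; apply: (dir_no_cycle uv); rewrite euv.
Qed.

Lemma connect_first e u v : connect e u v -> u != v ->
  exists2 x, e u x & connect e x v.
Proof.
move=> /connectP[[|x p] /=]; first by move=> _ ->; rewrite eqxx.
move=> /andP[ux xp] vp _; exists x => //.
by apply/connectP; exists p.
Qed.

Lemma connect_dir_antisym u v :
  connect (dir G) u v -> connect (dir G) v u -> u = v.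
Proof.
move=> uv vu; apply/eqP/negPn/negP=> /(connect_first uv)[x ux xv].
exact: (dir_no_cycle ux (connect_trans xv vu)).
Qed.

(** A repeated vertex would close a directed cycle; the distinctness required by [dpath] is thus
    automatic. *)
Lemma path_dir_uniq u p : path (dir G) u p -> uniq (u :: p).
Proof.
elim: p u => [|x p IH] u // /= /andP[ux xp].
have /= -> := IH x xp; rewrite andbT; apply/negP=> up.
apply: (dir_no_cycle ux); case/splitPl: up xp => p1 p2 <-.
by rewrite cat_path => /andP[xp1 _]; apply/connectP; exists p1.
Qed.

Lemma connect_restr_mem W e u v :
  connect (restr_rel W e) u v -> u != v -> (u \in W) && (v \in W).
Proof.
move=> /connectP[p]; elim: p u => [|x p IH] u /=.
  by move=> _ ->; rewrite eqxx.
move=> /andP[/and3P[-> xW _] xp] vp _ /=.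
have [->//|xv] := eqVneq v x.
by have /andP[] := IH x xp vp (contra_neq (@esym _ _ _) xv).
Qed.

Lemma connect_restrW W e u v : connect (restr_rel W e) u v -> connect e u v.
Proof.
by apply: connect_sub => x y /and3P[_ _ xy]; apply: connect1.
Qed.

(** Every vertex of a directed path that ends in an(c) is itself in an(c). *)
Lemma connect_restr_an c u v : connect (dir G) u v -> v \in an G c ->
  connect (restr_rel (an G c) (dir G)) u v.
Proof.
move=> /connectP[p]; elim: p u => [|x p IH] u /=; first by move=> _ -> _.
move=> /andP[ux xp] vp vc.
have xv : connect (dir G) x v by apply/connectP; exists p.
have uv := connect_trans (connect1 ux) xv.
apply: connect_trans (IH x xp vp vc); apply: connect1.
move: vc; rewrite /restr_rel !inE => vc.
by rewrite ux (connect_trans xv vc) (connect_trans uv vc).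
Qed.

End Graph.

(** * Path sums as entries of (I - Lambda)^{-1} *)

Section PathSum.
Context (R : realFieldType) (V : finType) (G : admg V) (L : vmatrix R V).
Context (L0 : forall i j, ~~ dir G i j -> entry L i j = 0).

Let weight (b : V) (t : seq V) : R :=
  \prod_(e <- zip (b :: t) t) entry L e.1 e.2.

(** An entry of Lambda^k: sequences that are not directed paths have weight 0. *)
Let walk_sum (k : nat) (b c : V) : R :=
  \sum_(t : k.-tuple V | last b t == c) weight b t.

Lemma weight_cons b x t : weight b (x :: t) = entry L b x * weight x t.
Proof. by rewrite /weight /= big_cons. Qed.

Lemma weight_path b t : ~~ path (dir G) b t -> weight b t = 0.
Proof.
elim: t b => [|x t IH] b //=; rewrite weight_cons negb_and.
case/orP=> [/L0 ->|/IH ->].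
  by rewrite mul0r.
by rewrite mulr0.
Qed.

Lemma path_sumE b c : path_sum G L b c = \sum_(k < #|V|) walk_sum k b c.
Proof.
apply: eq_bigr => k _; rewrite /walk_sum.
rewrite [RHS](bigID (fun t : k.-tuple V => dpath G b c t)) /=.
rewrite [X in _ = _ + X]big1 ?addr0.
  apply: eq_bigl => t; rewrite /dpath.
  by case: (last b t == c); rewrite ?andbF.
move=> t /andP[tc]; rewrite /dpath tc /= => nt.
apply: weight_path; apply: contra nt => bt.
by rewrite bt; apply: (path_dir_uniq bt).
Qed.

Lemma walk_sum0 b c : walk_sum 0 b c = (b == c)%:R.
Proof.
rewrite /walk_sum; case: eqP => [bc|bc].
  rewrite (big_pred1 [tuple]) => [|t]; last by rewrite tuple0 /= bc !eqxx.
  by rewrite /weight big_nil.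
by apply: big1 => t; rewrite tuple0 /= => /eqP.
Qed.

Lemma walk_sumS k b c :
  walk_sum k.+1 b c = \sum_x entry L b x * walk_sum k x c.
Proof.
rewrite /walk_sum; under [RHS]eq_bigr do rewrite mulr_sumr.
rewrite pair_big_dep /=.
rewrite (reindex (fun p : V * k.-tuple V => [tuple of p.1 :: p.2])) /=.
  by apply: eq_bigr => -[x t] _ /=; rewrite weight_cons.
exists (fun t : k.+1.-tuple V => (thead t, [tuple of behead t])).
  by move=> [x t] _; congr pair; apply: val_inj.
by move=> t _; rewrite /= -tuple_eta.
Qed.

(** Such a path would have [#|V|] + 1 distinct vertices; so Lambda is nilpotent. *)
Lemma walk_sum_max b c : walk_sum #|V| b c = 0.
Proof.
apply: big1 => t _; apply: weight_path; apply/negP=> /path_dir_uniq /card_uniqP.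
move=> /= ct; have := max_card (mem (b :: t)).
by rewrite ct size_tuple ltnn.
Qed.

(** The geometric series of Lambda telescopes and stops at the power [#|V|], which is 0. *)
Lemma path_sum_inverse :
  (1%:M - L) *m fun_mx (path_sum G L) = 1%:M.
Proof.
apply: entry_inj => b c; rewrite mulmxBl mul1mx entryB entryM entry1 fun_mxE.
under eq_bigr do rewrite fun_mxE path_sumE mulr_sumr.
rewrite exchange_big path_sumE -sumrB /=.
under eq_bigr do rewrite -walk_sumS.
rewrite -(big_mkord xpredT (fun k => walk_sum k b c - walk_sum k.+1 b c)).
rewrite (@telescope_sumr_eq _ _ _ (fun k => - walk_sum k b c)) //.
  by rewrite walk_sum_max oppr0 sub0r opprK walk_sum0.
by move=> k _; rewrite opprK addrC.
Qed.

Lemma unit_1B : 1%:M - L \in unitmx.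
Proof. by have [] := mulmx1_unit path_sum_inverse. Qed.

Lemma inverse_entry M : (1%:M - L) *m M = 1%:M -> invmx (1%:M - L) = M.
Proof.
move=> LM; apply: (can_inj (mulKmx unit_1B)).
by rewrite LM mulmxV ?unit_1B.
Qed.

Lemma path_sum_entry b c : entry (invmx (1%:M - L)) b c = path_sum G L b c.
Proof. by rewrite (inverse_entry path_sum_inverse) fun_mxE. Qed.

Lemma path_sum_connect b c : ~~ connect (dir G) b c -> path_sum G L b c = 0.
Proof.
move=> nbc; rewrite path_sumE big1 // => k _; apply: big1 => t /eqP tc.
apply: weight_path; apply: contra nbc => bt; apply/connectP.
by exists t.
Qed.

Lemma path_sum_refl b : path_sum G L b b = 1.
Proof.
have := congr1 (fun M => entry M b b) path_sum_inverse.
rewrite mulmxBl mul1mx entryB entryM entry1 fun_mxE eqxx big1 ?subr0 //.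
move=> x _; rewrite fun_mxE; have [bx|/L0 ->] := boolP (dir G b x).
  by rewrite path_sum_connect ?mulr0 //; apply/negP/(dir_no_cycle bx).
by rewrite mul0r.
Qed.

End PathSum.

(** * Fixability implies identification by the Markov blanket *)

Lemma fixable_regression_identified (R : realFieldType) (V : finType)
    (G : admg V) (b c : V) :
  c \in de G b :\ b -> fixable (induced G (an G c)) b ->
  regression_identified_by R G b c (mb (induced G (an G c)) b).
Proof.
rewrite !inE => /andP[cb bc]; set A := an G c; set H := induced G A => fixb.
have bA : b \in A by rewrite inE.
have DA x : x \in dis H b -> x \in A.
  rewrite inE => bx; have [<- //|nbx] := eqVneq b x.
  by have /andP[] := connect_restr_mem bx nbx.
have fixP x : x \in dis H b -> connect (dir G) b x -> x = b.
  move=> xD bx; apply/set1P; rewrite -fixb inE xD andbT inE.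
  by apply: connect_restr_an => //; apply: DA.
(* A district member is no descendant by fixability. If a parent s of a district member x descended
   from b, so would x; then x = b and the edge from s to b would close a cycle. *)
have mbP s : s \in mb H b -> s \in A /\ ~~ connect (dir G) b s.
  case/setUP; last first.
    case/setD1P=> sb sD; split; first exact: DA.
    by apply/negP=> /(fixP s sD)/eqP; apply/negP.
  rewrite inE => /existsP[x /andP[xD /and3P[sA _ sx]]]; split=> //.
  apply/negP=> bs; have xb := fixP x xD (connect_trans bs (connect1 sx)).
  by rewrite xb in sx; apply: dir_no_cycle sx bs.
have bS : b \notin mb H b by apply/negP=> /mbP[_]; rewrite connect0.
split.
  apply/subsetP=> s sS; have [_ nbs] := mbP s sS; rewrite !inE andbT negb_or.
  apply/andP; split; first by apply: contraNneq bS => sb; move: sS; rewrite sb.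
  by apply: contraNneq nbs => ->.
move=> L Om [L0 pO Om0]; have uL := unit_1B L0.
have bD : b \notin dis H b :\ b by rewrite !inE eqxx.
(* The regression is done for Omega, on the rest of the district, and carried over to Sigma by I -
   Lambda. *)
have [w rw _] := residual_exists pO bD; have [wb wD wr] := rw.
pose y := act (1%:M - L) w.
have w0 x : x \notin dis H b -> w x = 0.
  move=> xD; apply: wD; rewrite in_setU1 in_setD1 (negbTE xD) andbF orbF.
  by apply: contraNneq xD => ->; rewrite inE.
have yE x : y x = w x - act L w x.
  rewrite /y /act -[w x]act1 -sumrB; apply: eq_bigr => u _.
  by rewrite entryB mulrBl.
have By x : act (invmx (1%:M - L)) y x = w x.
  by rewrite -act_mul mulVmx // act1.
have Lw0 x : (forall u, u \in dis H b -> ~~ dir G x u) -> act L w x = 0.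
  move=> nD; apply: big1 => u _; have [uD|/w0 ->] := boolP (u \in dis H b).
    by rewrite L0 ?mul0r ?nD.
  by rewrite mulr0.
(* In the district this is the choice of [w]; outside it, no bidirected edge joins [x] to the
   support of [w]. *)
have Ow0 x : x \in A -> x != b -> act Om w x = 0.
  move=> xA xb; have [xD|xD] := boolP (x \in dis H b).
    by apply: wr; rewrite in_setD1 xb.
  apply: big1 => u _; have [uD|/w0 ->] := boolP (u \in dis H b); last first.
    by rewrite mulr0.
  rewrite Om0 ?mul0r //; first by apply: contraNneq xD => ->.
  apply: contra xD => xu; move: (uD); rewrite !inE => bu.
  apply: connect_trans bu (connect1 _).
  by rewrite /= /restr_rel xA DA // bid_sym.
(* Sources with a path to [x] lie in an(c), where only [b] has a nonzero value of Omega w. *)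
have Sy x : x \in A ->
    act (covariance L Om) y x = path_sum G L b x * act Om w b.
  move=> xA; rewrite act_covariance (bigD1 b) //= (path_sum_entry L0).
  rewrite big1 ?addr0; first by congr (_ * _); apply: act_ext.
  move=> u ub; rewrite (path_sum_entry L0) (act_ext _ _ By).
  have [ux|/(path_sum_connect L0) ->] := boolP (connect (dir G) u x).
    by rewrite Ow0 ?mulr0 //; move: xA; rewrite !inE; apply: connect_trans.
  by rewrite mul0r.
(* The value at [b] is still 1 because no child of [b] lies in its district; Lambda w lives on the
   parents of the district. *)
have ry : residual (covariance L Om) b (mb H b) y.
  split.
  - rewrite yE wb Lw0 ?subr0 // => u uD; apply/negP=> bu.
    have ub := fixP u uD (connect1 bu).
    by have := dir_neq bu; rewrite ub eqxx.
  - move=> u; rewrite !in_setU !in_set1 !negb_or => /and3P[ub upa uD].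
    rewrite yE w0 ?Lw0 ?subr0 //; last first.
      by move: uD; rewrite in_setD1 ub.
    move=> x xD; apply: contra upa => ux; rewrite inE; apply/existsP; exists x.
    rewrite xD -[dir H u x]/[&& u \in A, x \in A & dir G u x] (DA x) // ux.
    by have := DA x xD; rewrite !inE => /(connect_trans (connect1 ux)) ->.
  - move=> s /mbP[sA /(path_sum_connect L0) bs].
    by rewrite Sy // bs mul0r.
have pS := posdef_covariance uL pO.
apply: esym; apply: (proj2 (beta_residual _ _ pS bS ry)).
by rewrite !Sy ?path_sum_refl ?mul1r //; rewrite inE connect0.
Qed.

(** * Parameters concentrated on a forest *)

Section PosDef.
Context (R : realFieldType) (V : finType).
Implicit Types (y : V -> R).

Lemma sum_sqr_gt0 y u : y u != 0 -> 0 < \sum_v y v * y v.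
Proof.
move=> yu; rewrite (bigD1 u) //= ltr_pwDl //.
  by rewrite -expr2 exprn_even_gt0.
by apply: sumr_ge0 => v _; rewrite -expr2 sqr_ge0.
Qed.

Lemma posdef1 : posdef (1%:M : vmatrix R V).
Proof.
apply/posdefP; split=> [u v|y [u yu]]; first by rewrite !entry1 eq_sym.
by under eq_bigr do rewrite act1; apply: sum_sqr_gt0 yu.
Qed.

(* Its quadratic form is |y|^2 plus the sum of e u v (y u + y v)^2 / 2. *)
Definition dominant_mx (e : rel V) : vmatrix R V :=
  fun_mx (fun u v =>
    (u == v)%:R * (1 + \sum_x (e u x)%:R) + (e u v)%:R).

Lemma act_dominant e y u : act (dominant_mx e) y u =
  (1 + \sum_x (e u x)%:R) * y u + \sum_v (e u v)%:R * y v.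
Proof.
rewrite /act; under eq_bigr do rewrite fun_mxE mulrDl.
rewrite big_split /= (bigD1 u) //= eqxx mul1r.
rewrite [X in _ + X + _]big1 ?addr0 // => v vu.
by rewrite eq_sym (negbTE vu) !mul0r.
Qed.

Lemma posdef_dominant e : symmetric e -> posdef (dominant_mx e).
Proof.
move=> sym_e; apply/posdefP; split=> [u v|y [u yu]].
  by rewrite !fun_mxE sym_e; have [->|] := eqVneq u v; rewrite ?mul0r.
pose Q := \sum_u \sum_v (e u v)%:R * (y u * y u + y u * y v).
have -> : \sum_u y u * act (dominant_mx e) y u = \sum_u y u * y u + Q.
  rewrite -big_split; apply: eq_bigr => v _ /=.
  rewrite act_dominant mulrDl mul1r -addrA mulrDr; congr (_ + _).
  rewrite mulr_suml -big_split mulr_sumr; apply: eq_bigr => x _ /=.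
  by rewrite -mulrDr mulrCA mulrDr.
(* Adding to [Q] its copy with the two sums exchanged completes the squares. *)
apply: ltr_wpDr (sum_sqr_gt0 yu); rewrite -(pmulrn_lge0 _ (ltn0Sn 1)) mulr2n.
rewrite {2}/Q exchange_big -big_split; apply: sumr_ge0 => v _ /=.
rewrite -big_split; apply: sumr_ge0 => x _ /=.
rewrite [e x v]sym_e -mulrDr mulr_ge0 ?ler0n //.
suff -> : y v * y v + y v * y x + (y x * y x + y x * y v) = (y v + y x) ^+ 2.
  exact: sqr_ge0.
by rewrite expr2 mulrDl !mulrDr [y x * y x + _]addrC.
Qed.
End PosDef.

(** * Flows along a directed forest *)

Section Flow.
Context (V : finType) (G : admg V).
Implicit Types (u v x t b c s : V) (f : V -> V) (P Q : pred V).

(** The vertex [u] itself is lost. The number of descendants serves as termination measure and to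
    pick last vertices. *)
Lemma card_de_lt u v : connect (dir G) u v -> u != v ->
  (#|de G v| < #|de G u|)%N.
Proof.
move=> uv nuv; apply: proper_card; apply/properP; split.
  by apply/subsetP=> x; rewrite !inE; apply: connect_trans.
exists u; rewrite !inE ?connect0 //.
by apply: contraNN nuv => vu; apply/eqP/(connect_dir_antisym uv vu).
Qed.

(* Equal to x itself when x = t or when t is not a descendant of x. *)
Definition toward t x : V :=
  odflt x [pick z | dir G x z && connect (dir G) z t].

Lemma towardP t x : connect (dir G) x t -> x != t ->
  dir G x (toward t x) /\ connect (dir G) (toward t x) t.
Proof.
move=> xt nxt; rewrite /toward; case: pickP => [z /andP[] //|none].
have [z xz zt] := connect_first xt nxt.
by have := none z; rewrite xz zt.
Qed.

Lemma toward_dir t x : toward t x != x -> dir G x (toward t x).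
Proof. by rewrite /toward; case: pickP => [z /andP[] //|_]; rewrite eqxx. Qed.

Section Forest.
Context (f : V -> V) (f_dir : forall x, f x != x -> dir G x (f x)).

Lemma fconnect_dir x y : fconnect f x y -> connect (dir G) x y.
Proof.
apply: connect_sub => u v /eqP <-.
have [->|/f_dir] := eqVneq (f u) u; first exact: connect0.
exact: connect1.
Qed.

(** Each step of [f] loses a descendant, so the walk stops, and inside [P] it can stop only in
    [Q]. *)
Lemma flow_exists P Q :
  (forall x, P x -> ~~ Q x -> P (f x) /\ f x != x) ->
  forall x, P x -> exists t, [/\ Q t, P t & fconnect f x t].
Proof.
move=> fP x; have [n] := ubnP #|de G x|; elim: n x => // n IH x le_n Px.
have [Qx|nQx] := boolP (Q x); first by exists x.
have [Pfx fx] := fP x Px nQx.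
have lt_f : (#|de G (f x)| < #|de G x|)%N.
  by apply: card_de_lt; rewrite 1?eq_sym ?connect1 ?f_dir.
have [t [Qt Pt ft]] := IH (f x) (leq_trans lt_f le_n) Pfx.
by exists t; split=> //; apply: connect_trans (fconnect1 f x) ft.
Qed.

Lemma fconnect_fix t x : f t = t -> fconnect f t x -> x = t.
Proof.
move=> ft /iter_findex <-; elim: (findex _ _ _) => //= n ->.
exact: ft.
Qed.

Lemma fconnect_comparable u x y : fconnect f u x -> fconnect f u y ->
  fconnect f x y \/ fconnect f y x.
Proof.
move=> /iter_findex <- /iter_findex <-.
move: (findex _ _ x) (findex _ _ y) => n m.
case/orP: (leq_total n m) => [nm|mn]; [left|right].
  by rewrite -(subnK nm) iterD fconnect_iter.
by rewrite -(subnK mn) iterD fconnect_iter.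
Qed.

Lemma fconnect_fix_unique u t t' : f t = t -> f t' = t' ->
  fconnect f u t -> fconnect f u t' -> t = t'.
Proof.
move=> ft ft' ut ut'.
by case: (fconnect_comparable ut ut') => /fconnect_fix ->.
Qed.

Context (R : realFieldType).

(* A fixed point of f stands for a vertex without outgoing edge. *)
Definition flow_mx : vmatrix R V :=
  fun_mx (fun x y => ((f x == y) && (x != y))%:R).

Lemma flow_mxE x y : entry flow_mx x y = ((f x == y) && (x != y))%:R.
Proof. exact: fun_mxE. Qed.

Lemma flow_mx_dir i j : ~~ dir G i j -> entry flow_mx i j = 0.
Proof.
rewrite flow_mxE; case: eqP => //= <-.
by have [//|fi /negP[]] := eqVneq i (f i); apply: f_dir; rewrite eq_sym.
Qed.

(** A vertex has at most one outgoing edge, of weight 1, so at most one weighted path leads from [x]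
    to [y]. *)
Lemma flow_mx_inverse x y :
  entry (invmx (1%:M - flow_mx)) x y = (fconnect f x y)%:R.
Proof.
have -> : invmx (1%:M - flow_mx) = fun_mx (fun x y => (fconnect f x y)%:R).
  apply: (inverse_entry flow_mx_dir); apply: entry_inj => u v.
  rewrite mulmxBl mul1mx entryB entryM entry1 fun_mxE.
  rewrite (bigD1 (f u)) //= big1 ?addr0; last first.
    by move=> z zu; rewrite flow_mxE eq_sym (negbTE zu) mul0r.
  rewrite flow_mxE !fun_mxE eqxx /= fconnect_eqVf.
  have [fu|fu] := eqVneq u (f u).
    rewrite -fu mul0r subr0; have [//|/= uv] := eqVneq u v.
    case uv': (fconnect f u v) => //.
    by rewrite (fconnect_fix _ uv') ?eqxx in uv.
  have [<-|uv] := eqVneq u v; last by rewrite /= mul1r subrr.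
  suff /negbTE -> : ~~ fconnect f (f u) u by rewrite mulr0 subr0.
  apply/negP=> /fconnect_dir; apply: dir_no_cycle.
  by apply: f_dir; rewrite eq_sym.
by rewrite fun_mxE.
Qed.

Lemma path_sum_flow x y : path_sum G flow_mx x y = (fconnect f x y)%:R.
Proof. by rewrite -(path_sum_entry flow_mx_dir) flow_mx_inverse. Qed.

End Forest.
End Flow.

(** * Identification implies fixability *)

Lemma no_causal_covariate (R : realFieldType) (V : finType) (G : admg V)
    (b c : V) (S : {set V}) (s : V) :
  regression_identified_by R G b c S -> s \in S -> connect (dir G) b s ->
  ~~ connect (dir G) s c.
Proof.
move=> [/subsetP sub ident] sS bs; apply/negP=> sc.
have neS x : x \in S -> x != b /\ x != c.
  by move/sub; rewrite !inE negb_or andbT => /andP.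
pose P x := [&& x \in S, connect (dir G) b x & connect (dir G) x c].
have Ps : P s by apply/and3P.
(* Fewest descendants: no other element of [S] lies between the new [s] and [c]. *)
case: (arg_minnP (fun x => #|de G x|) Ps).
move=> {sS bs sc Ps}s /and3P[sS bs sc] s_min.
have [sb s_c] := neS s sS.
have s_last x : x \in S -> connect (dir G) s x -> connect (dir G) x c -> x = s.
  move=> xS sx xc; apply/eqP/negPn/negP=> nxs.
  have := s_min x; rewrite /P xS xc (connect_trans bs sx) => /(_ isT).
  by rewrite leqNgt card_de_lt // eq_sym.
pose f x := if [&& connect (dir G) b x, connect (dir G) x s & x != s]
            then toward G s x
            else if connect (dir G) s x && connect (dir G) x c && (x != c)
            then toward G c x else x.
have f_dir x : f x != x -> dir G x (f x).
  rewrite /f; case: ifP => _; first exact: toward_dir.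
  by case: ifP => _; [exact: toward_dir | rewrite eqxx].
have to_s x : connect (dir G) b x -> connect (dir G) x s -> fconnect f x s.
  move=> bx xs.
  have [z /andP[bz zs] /= nzs||t [/eqP -> _]] := flow_exists f_dir
    (P := [pred z | connect (dir G) b z && connect (dir G) z s])
    (Q := pred1 s) _ (x := x).
  - rewrite /f bz zs nzs /=; have [zn ns] := towardP zs nzs.
    rewrite ns (connect_trans bz (connect1 zn)); split=> //.
    by rewrite eq_sym (dir_neq zn).
  - by rewrite /= bx.
  - by [].
have to_c x : connect (dir G) s x -> connect (dir G) x c -> fconnect f x c.
  move=> sx xc.
  have [z /andP[sz zc] /= nzc||t [/eqP -> _]] := flow_exists f_dir
    (P := [pred z | connect (dir G) s z && connect (dir G) z c])
    (Q := pred1 c) _ (x := x).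
  - rewrite /f sz zc nzc /=; have [zn nc] := towardP zc nzc.
    have -> : [&& connect (dir G) b z, connect (dir G) z s & z != s] = false.
      by apply/and3P=> -[_ zs]; rewrite (connect_dir_antisym zs sz) eqxx.
    rewrite nc (connect_trans sz (connect1 zn)); split=> //.
    by rewrite eq_sym (dir_neq zn).
  - by rewrite /= sx.
  - by [].
have sfc : fconnect f s c by apply: to_c; rewrite ?connect0.
have bfc : fconnect f b c.
  by apply: connect_trans sfc; apply: to_s; rewrite ?connect0.
have fc : f c = c.
  rewrite /f eqxx andbF; case: and3P => // -[_ cs _].
  by rewrite (connect_dir_antisym cs sc) eqxx in s_c.
have L0 := flow_mx_dir f_dir R; set L := flow_mx f R in L0.
have uL := unit_1B L0.
have pS := posdef_covariance uL (posdef1 R V).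
have bS : b \notin S by apply/negP=> /neS[]; rewrite eqxx.
have [y ry _] := residual_exists pS bS; have [yb yS yr] := ry.
pose w := act (invmx (1%:M - L)) y.
have Sy v : act (covariance L 1%:M) y v = \sum_u (fconnect f u v)%:R * w u.
  rewrite act_covariance; apply: eq_bigr => u _.
  by rewrite (flow_mx_inverse f_dir) act1.
(* The flow from [u] stays strictly beyond [s], so it meets neither [b] nor [S], and [y] vanishes
   along it. *)
have w0 u : connect (dir G) s u -> connect (dir G) u c -> u != s -> w u = 0.
  move=> su uc us; apply: big1 => x _; rewrite (flow_mx_inverse f_dir).
  case ux: (fconnect f u x); last by rewrite mul0r.
  have dux := fconnect_dir f_dir ux.
  rewrite yS ?mulr0 // !inE negb_or; apply/andP; split.
    apply: contraNneq sb => xb; rewrite xb in dux.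
    by rewrite (connect_dir_antisym bs (connect_trans su dux)).
  apply/negP=> xS; have xc : connect (dir G) x c.
    have [/(fconnect_dir f_dir) //|] := fconnect_comparable ux (to_c u su uc).
    by move/(fconnect_fix fc) ->.
  have xs := s_last x xS (connect_trans su dux) xc; rewrite xs in dux.
  by rewrite (connect_dir_antisym dux su) eqxx in us.
(* A source flowing to [c] either passes through [s] or starts strictly beyond it, where [w] is 0;
   so Sigma y takes the same value at [c] as at [s]. *)
have Syc : act (covariance L 1%:M) y c = 0.
  rewrite -(yr s sS) !Sy; apply: eq_bigr => u _.
  case us: (fconnect f u s); first by rewrite (connect_trans us sfc).
  case uc: (fconnect f u c) => //; rewrite mul0r mul1r.
  have ucd := fconnect_dir f_dir uc.
  have nus : u != s by apply: contraFneq us => ->; apply: connect0.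
  have [uc'|nuc] := eqVneq u c; first by apply: w0; rewrite // uc'.
  have fu : f u != u.
    by apply: contra_neq nuc => fu; rewrite (fconnect_fix fu uc).
  move: fu; rewrite /f; case: ifP => [/and3P[bu uds _]|_].
    by rewrite to_s in us.
  by case: ifP => [/andP[/andP[su _] _] _|]; [apply: w0 | rewrite eqxx].
have par : lsem_params G L 1%:M.
  split=> //; first exact: posdef1.
  by move=> i j ij _; rewrite entry1 (negbTE ij).
have := ident L 1%:M par; rewrite path_sum_flow // bfc => /esym.
move/(beta_residual _ _ pS bS ry); rewrite Syc mul1r => /esym y0.
by have := residual_gt0 pS bS ry; rewrite y0 ltxx.
Qed.

Lemma regression_identified_fixable (R : realFieldType) (V : finType)
    (G : admg V) (b c : V) (S : {set V}) :
  c \in de G b :\ b -> regression_identified_by R G b c S ->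
  fixable (induced G (an G c)) b.
Proof.
move=> /setD1P[cb]; rewrite inE => bc idS.
have noS := no_causal_covariate idS; have [/subsetP sub ident] := idS.
have neS x : x \in S -> x != b /\ x != c.
  by move/sub; rewrite !inE negb_or andbT => /andP.
apply/eqP/negPn/negP; set A := an G c; set H := induced G A => nfix.
have bA : b \in A by rewrite inE.
have [v [vb bv vA vD]] : exists v, [/\ v != b, connect (dir G) b v, v \in A
    & connect (restr_rel A (bid G)) b v].
  have /set0Pn[v] : (de H b :&: dis H b) :\ b != set0.
    rewrite setD_eq0; apply: contra nfix => sub_b; rewrite eqEsubset sub_b.
    by rewrite sub1set !inE connect0 connect0.
  rewrite !inE => /andP[vb /andP[bv vD]]; exists v; split=> //.
    exact: connect_restrW bv.
  by have /andP[] := connect_restr_mem bv (contra_neq (@esym _ _ _) vb).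
pose Q := b |: (c |: S).
pose f x := if (x \in A) && (x \notin Q) then toward G c x else x.
have f_dir x : f x != x -> dir G x (f x).
  by rewrite /f; case: ifP => _; [exact: toward_dir | rewrite eqxx].
have fA x : x \in A -> x \notin Q -> [/\ f x \in A, f x != x & dir G x (f x)].
  move=> xA xQ; rewrite /f xA xQ /=; have xc : x != c.
    by apply: contraNneq xQ => ->; rewrite !inE eqxx orbT.
  have [|xf fc] := @towardP _ G c x _ xc; first by rewrite inE in xA.
  by rewrite inE fc xf eq_sym (dir_neq xf).
have fQ t : t \in Q -> f t = t by rewrite /f => ->; rewrite andbF.
(* The terminal of [u]. The default is returned only when the flow of [u] misses [Q], and then [u]
   is not in [Q] either. *)
pose T u := odflt u [pick t | (t \in Q) && fconnect f u t].
have TE u t : t \in Q -> fconnect f u t = (T u == t).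
  move=> tQ; rewrite /T; case: pickP => [t' /andP[t'Q ut']|none] /=.
    apply/idP/eqP=> [ut|<- //].
    exact: (fconnect_fix_unique (fQ _ t'Q) (fQ _ tQ) ut' ut).
  apply/idP/eqP=> [ut|->]; last exact: connect0.
  by have := none t; rewrite tQ ut.
have TA u : u \in A -> T u \in Q.
  move=> uA.
  have [z zA zQ||t [tQ _]] := flow_exists f_dir
    (P := mem A) (Q := mem Q) _ (x := u).
  - by have [] := fA z zA zQ.
  - by [].
  - by rewrite (TE u t tQ) => /eqP ->.
have Tb : T b = b by apply/eqP; rewrite -TE ?connect0 // setU11.
(* The flow stays among proper descendants of [b] in an(c), and none of these is in [S]. *)
have Tv : T v = c.
  have [z /and3P[zA bz zb] zQ||t [tQ /and3P[tA bt tb]]] := flow_exists f_dir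
    (P := [pred z | [&& z \in A, connect (dir G) b z & z != b]])
    (Q := mem Q) _ (x := v).
  - have [fzA fz zf] := fA z zA zQ; split=> //=; rewrite fzA.
    rewrite (connect_trans bz (connect1 zf)) /=.
    by apply/eqP=> fzb; apply: (dir_no_cycle zf); rewrite fzb.
  - by rewrite /= vA bv.
  - rewrite (TE v t tQ) => /eqP ->; move: tQ; rewrite !inE (negbTE tb) /=.
    case/orP=> [/eqP //|tS]; have := noS t tS bt.
    by move: tA; rewrite inE => ->.
pose q t t' := [exists u, exists u',
  [&& T u == t, T u' == t', u \in A, u' \in A & bid G u u']].
have qbc : connect q b c.
  have Tq : forall u u',
      connect (restr_rel A (bid G)) u u' -> connect q (T u) (T u').
    move=> u _ /connectP[p up ->]; elim: p u up => [|x p IH] u //=.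
    move=> /andP[/and3P[uA xA ux] xp]; apply: connect_trans (IH x xp).
    apply: connect1; apply/existsP; exists u; apply/existsP; exists x.
    by rewrite !eqxx uA xA.
  by have := Tq b v vD; rewrite Tb Tv.
(* Distinct terminals make the position in the path determine the terminal. *)
case/connectP: qbc => p0 /shortenP[p qp up _] cp {p0}.
pose s := b :: p.
pose e t t' := [&& t \in s, t' \in s &
  (index t s == (index t' s).+1) || (index t' s == (index t s).+1)].
have sym_e : symmetric e by move=> t t'; rewrite /e andbCA orbC.
(* A bidirected edge gets weight only if its ends flow to consecutive terminals of [s]. *)
pose N u u' := bid G u u' && e (T u) (T u').
have sym_N : symmetric N by move=> u u'; rewrite /N bid_sym sym_e.
have sQ t : t \in s -> t \in Q.
  rewrite inE => /orP[/eqP ->|]; first by rewrite setU11.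
  move: qp; rewrite /s; elim: (p) (b) => //= x p1 IH b1 /andP[bx xp1].
  rewrite inE => /orP[/eqP ->|]; last exact: IH xp1.
  by have /existsP[u /existsP[u' /and5P[_ /eqP <- _ u'A _]]] := bx; apply: TA.
have pO := posdef_dominant R sym_N; set Om := dominant_mx R N in pO.
have L0 := flow_mx_dir f_dir R; set L := flow_mx f R in L0.
have uL := unit_1B L0; have pS := posdef_covariance uL pO.
have bS : b \notin S by apply/negP=> /neS[]; rewrite eqxx.
have [y ry _] := residual_exists pS bS; have [yb yS yr] := ry.
have yQ t : t \notin Q -> y t = 0.
  move=> tQ; apply: yS; apply: contra tQ.
  by rewrite !inE => /orP[|] ->; rewrite ?orbT.
have ByE u : act (invmx (1%:M - L)) y u = y (T u).
  have tE t : entry (invmx (1%:M - L)) u t * y t = (T u == t)%:R * y t.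
    rewrite (flow_mx_inverse f_dir); have [tQ|/yQ ->] := boolP (t \in Q).
      by rewrite TE.
    by rewrite !mulr0.
  rewrite /act; under eq_bigr do rewrite tE.
  rewrite (bigD1 (T u)) //= eqxx mul1r big1 ?addr0 // => t Tt.
  by rewrite eq_sym (negbTE Tt) mul0r.
(* The diagonal of Omega contributes a multiple of [y t], which is 0. *)
have Sy t : t \in Q -> y t = 0 -> act (covariance L Om) y t =
    \sum_u \sum_u' ((T u == t) && N u u')%:R * y (T u').
  move=> tQ yt; rewrite act_covariance; apply: eq_bigr => u _.
  rewrite (flow_mx_inverse f_dir) TE // (act_ext _ _ ByE) act_dominant.
  case: eqP => [->|_] /=; last by rewrite mul0r big1 // => u' _; rewrite mul0r.
  by rewrite mul1r yt mulr0 add0r.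
have par : lsem_params G L Om.
  split=> // i j ij nij; rewrite fun_mxE (negbTE ij) mul0r add0r.
  by rewrite /N (negbTE nij).
have tau0 : path_sum G L b c = 0.
  rewrite (path_sum_flow f_dir) TE ?Tb; last by rewrite !inE eqxx orbT.
  by rewrite eq_sym (negbTE cb).
have Syc : act (covariance L Om) y c = 0.
  have := ident L Om par; rewrite tau0 => /esym.
  by move/(beta_residual _ _ pS bS ry); rewrite mul0r.
have yc : y c = 0.
  by apply: yS; rewrite !inE negb_or cb /=; apply/negP=> /neS[_]; rewrite eqxx.
have Sy0 t : t \in Q -> t != b -> act (covariance L Om) y t = 0.
  by rewrite !inE => /or3P[/eqP ->|/eqP -> //|/yr //]; rewrite eqxx.
have size_s : size s = (size p).+1 by [].
(* Induction from the end of [s], whose last index is [size p]. The equation at the successor [t1]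
   of [t] involves only [y t] and the value after [t1], already known to be 0. *)
have ys0 n t : t \in s -> (size p <= index t s + n)%N -> y t = 0.
  elim: n t => [|n IH] t ts; rewrite ?addn0 => le_n.
    have it : index t s = size p.
      by apply/eqP; rewrite eqn_leq le_n andbT -ltnS -size_s index_mem.
    have tc : t = c by rewrite -(nth_index b ts) it cp nth_last.
    by rewrite tc.
  have [lt_t|ge_t] := ltnP (index t s) (size p); last first.
    by apply: IH => //; apply: leq_trans ge_t (leq_addr _ _).
  pose t1 := nth b s (index t s).+1.
  have lt1 : ((index t s).+1 < size s)%N by rewrite size_s ltnS.
  have t1s : t1 \in s by apply: mem_nth.
  have it1 : index t1 s = (index t s).+1 by apply: index_uniq.
  have yt1 : y t1 = 0 by apply: IH; rewrite // it1 addSnnS.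
  have t1b : t1 != b.
    by apply/eqP=> t1b; move: it1; rewrite t1b /s /= eqxx.
  have := Sy0 t1 (sQ t1 t1s) t1b; rewrite (Sy t1 (sQ t1 t1s) yt1).
  (* The coefficient of [y t] counts bidirected edges between the vertices flowing to [t1] and those
     flowing to [t]. *)
  pose M u u' := [&& T u == t1, N u u' & T u' == t].
  have -> : \sum_u \sum_u' ((T u == t1) && N u u')%:R * y (T u') =
      (\sum_u \sum_u' M u u')%:R * y t.
    rewrite natr_sum mulr_suml; apply: eq_bigr => u _.
    rewrite natr_sum mulr_suml; apply: eq_bigr => u' _.
    rewrite /M; case: eqP => [Tu|_] /=; last by rewrite !mul0r.
    case Nu: (N u u') => /=; last by rewrite !mul0r.
    have [-> //|Tu't] := eqVneq (T u') t; rewrite mul0r mul1r.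
    case/andP: Nu => _; rewrite /e Tu it1 => /and3P[_ Tu's /orP[]/eqP i_eq].
      case/eqP: Tu't; rewrite -(nth_index b Tu's).
      by rewrite -(succn_inj i_eq) nth_index.
    apply: IH => //; rewrite i_eq addSnnS; apply: leq_trans le_n _.
    by rewrite leq_add2r leqnSn.
  move/eqP; rewrite mulf_eq0 pnatr_eq0 sum_nat_eq0 => /orP[/forallP M0|/eqP //].
  (* This count is not 0, since the path of terminals comes from actual bidirected edges. *)
  have : q t t1.
    have := pathP b qp (index t s) lt_t.
    by rewrite -/s (nth_index b ts).
  case/existsP=> u' /existsP[u /and5P[/eqP Tu' /eqP Tu _ _ u'u]].
  have := M0 u; rewrite sum_nat_eq0 => /forallP/(_ u').
  rewrite /M Tu Tu' !eqxx /N bid_sym u'u /e Tu Tu' t1s ts it1 eqxx.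
  by [].
have := ys0 (size p) b (mem_head _ _) (leq_addl _ _).
by rewrite yb => /eqP; rewrite oner_eq0.
Qed.

Theorem theorem3p7 (R : realType) (V : finType) (G : admg V) (b c : V)
    (hc : c \in de G b :\ b) :
  (regression_identifiable R G b c <-> fixable (induced G (an G c)) b) /\
  (fixable (induced G (an G c)) b ->
   regression_identified_by R G b c (mb (induced G (an G c)) b)).
Proof.
have mb_ident := @fixable_regression_identified R V G b c hc.
split; last exact: mb_ident.
split=> [[S idS]|fixb]; first exact: regression_identified_fixable hc idS.
by exists (mb (induced G (an G c)) b); apply: mb_ident.
Qed.
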